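(* Let $T\subseteq\mathbb{R}^d$ be such that the family $\{I_t: t\in T\}$, $I_t=[0,1)^d+t$, is a cube tiling of $\mathbb{R}^d$ (i.e. $\mathbb{R}^d=\bigcup_{t\in T}I_t$ and $I_u\cap I_v=\emptyset$ for distinct $u,v\in T$). Let $W=\{t\in T: I_t\cap[0,1]^d\neq\emptyset\}$, regarded as a set of words over the alphabet $S=(-1,1]$ (so $W\subseteq S^d$), and let $W^+,W^-$ be an induced decomposition of $W$. Put $T^+=W^++2\mathbb{Z}^d$ and $T^-=W^-+2\mathbb{Z}^d$. If $z\in\mathbb{R}^d$ is such that $I_z$ is disjoint from $I_t$ for every $t\in T^+$, then $z\in T^-$.
   Context: The alphabet $S=(-1,1]$ carries the complementation $s\mapsto s'$ defined by $|s-s'|=1$, $s'\in S$ (so $s'=s-1$ if $s>0$ and $s'=s+1$ if $s\le 0$). Elements of $S^d$ (words) are written as vectors $w=(w_1,\dots,w_d)$. For $w\in S^d$ and $\varepsilon\in\mathbb{Z}_2^d$, $w^\varepsilon$ is the word whose $i$-th letter is $w_i$ if $\varepsilon_i=0$ and $w_i'$ if $\varepsilon_i=1$; let $|\varepsilon|=|\{i:\varepsilon_i=1\}|$ and $C_w=\{w^\varepsilon:\varepsilon\in\mathbb{Z}_2^d\}$. Two elements $u,v\in C_w$ carry the same sign if $(-1)^{|\varepsilon|}=1$ for the unique $\varepsilon$ with $u^\varepsilon=v$; this splits $C_w$ into two classes, and an orientation of $C_w$ is a choice of one class as $C_w^+$ and the other as $C_w^-$. Given a set of words $W$ and an orientation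 chosen for each of the sets $C_w$, $w\in W$, the induced decomposition of $W$ is $W^+=W\cap\bigcup_{w\in W}C_w^+$, $W^-=W\cap\bigcup_{w\in W}C_w^-$. *)

(* Defs.v *)
From HB Require Import structures.
From mathcomp Require Import all_boot all_order all_algebra.
From mathcomp Require Import all_classical all_reals.
From mathcomp Require Import lra.

Set Implicit Arguments.
Unset Strict Implicit.
Unset Printing Implicit Defensive.

Import Order.TTheory GRing.Theory Num.Theory.
Local Open Scope classical_set_scope.
Local Open Scope ring_scope.

Section Words.
Variables (R : realType) (d : nat).
Implicit Types (s : R) (u v w t : 'rV[R]_d) (e : 'rV['Z_2]_d).
Implicit Types (C W T : set 'rV[R]_d).

Definition alphabet : set R := [set s | -1 < s <= 1].

(* Total on R, but meaningful only on the alphabet: see complP. *)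
Definition compl s : R := if 0 < s then s - 1 else s + 1.

Lemma complP s s' : alphabet s ->
  (alphabet s' /\ `|s - s'| = 1) <-> s' = compl s.
Proof.
rewrite /alphabet /compl /= => /andP[s1 s2]; split.
  case=> /andP[a b] /eqP; rewrite eqr_norml ler01 andbT => /orP[]/eqP h;
    case: ltP => h0; lra.
move=> ->; case: (ltP 0 s) => h0; (split; first by apply/andP; split; lra).
  by rewrite opprB addrC subrK normr1.
by rewrite opprD addNKr normrN normr1.
Qed.

Definition words : set 'rV[R]_d := [set w | forall i, alphabet (w 0 i)].

Definition flip w e : 'rV[R]_d :=
  \row_i (if e 0 i == 1 then compl (w 0 i) else w 0 i).

Definition weight e : nat := #|[pred i | e 0 i == 1]|.

Lemma flip_inj w : injective (flip w).
Proof.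
have compl_neq s : compl s <> s by rewrite /compl; case: ltP => _; lra.
have Z2 (x y : 'Z_2) : (x == 1) = (y == 1) -> x = y.
  by case: x y => [[|[|?]] ?] [[|[|?]] ?] // _; apply: val_inj.
move=> e f /rowP h; apply/rowP => i; apply: Z2.
have := h i; rewrite !mxE.
by case: (e 0 i == 1); case: (f 0 i == 1) => //;
  first [move=> /compl_neq | move=> /esym/compl_neq].
Qed.

(* The set C_w. *)
Definition flips w : set 'rV[R]_d := range (flip w).

(* By flip_inj the witness e is unique. *)
Definition same_sign u v : Prop :=
  exists e, flip u e = v /\ (-1) ^+ weight e = 1 :> int.

Definition sign_class C u : set 'rV[R]_d := [set v | C v /\ same_sign u v].

(* For d > 0, C = flips w with w a word has exactly two sign classes, so Cm is
   determined by Cp. *)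
Definition orientation C (Cp Cm : set 'rV[R]_d) : Prop :=
  [/\ exists2 u, C u & Cp = sign_class C u,
      exists2 v, C v & Cm = sign_class C v
    & Cp <> Cm].

(* The orientation depends on the set C_w and not on w: words w with the same
   C_w get the same orientation, hence cp and cm are indexed by sets. *)
Definition induced_decomposition W (Wp Wm : set 'rV[R]_d) : Prop :=
  exists cp cm : set 'rV[R]_d -> set 'rV[R]_d,
    [/\ forall w, W w -> orientation (flips w) (cp (flips w)) (cm (flips w)),
        Wp = W `&` \bigcup_(w in W) cp (flips w)
      & Wm = W `&` \bigcup_(w in W) cm (flips w)].

Definition half_open_cube : set 'rV[R]_d :=
  [set x | forall i, 0 <= x 0 i < 1].

Definition closed_cube : set 'rV[R]_d :=
  [set x | forall i, 0 <= x 0 i <= 1].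

Definition cube t : set 'rV[R]_d := [set x + t | x in half_open_cube].

Definition cube_tiling T : Prop :=
  \bigcup_(t in T) cube t = setT /\
  (forall u v, T u -> T v -> u <> v -> cube u `&` cube v = set0).

Definition meeting_closed_cube T : set 'rV[R]_d :=
  [set t | T t /\ cube t `&` closed_cube !=set0].

Lemma meeting_closed_cube_words T : meeting_closed_cube T `<=` words.
Proof.
move=> t [_ [_ [[x xI <-] xJ]]] i.
move: (xI i) (xJ i); rewrite !mxE /alphabet /= => /andP[a b] /andP[c e].
by apply/andP; split; lra.
Qed.

Definition add_2Zd (A : set 'rV[R]_d) : set 'rV[R]_d :=
  [set a + \row_i (2 * (k 0 i)%:~R) | a in A & k in [set: 'rV[int]_d]].

End Words.

Arguments words : clear implicits.
Arguments half_open_cube : clear implicits.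
Arguments closed_cube : clear implicits.

(* Main.v *)
Require Import Defs.
From HB Require Import structures.
From mathcomp Require Import all_boot all_order all_algebra.
From mathcomp Require Import all_classical all_reals.
From mathcomp Require Import lra.

Set Implicit Arguments.
Unset Strict Implicit.
Unset Printing Implicit Defensive.

Import Order.TTheory GRing.Theory Num.Theory.
Local Open Scope classical_set_scope.
Local Open Scope ring_scope.

(** Write [W] for the tiles meeting the closed unit cube and [s'] for [compl s].
   If functions [p i] on the alphabet satisfy [p i s + p i s' = c i], then
   the sum over [w] in [W] of the products of the [p i (w 0 i)] is the product
   of the [c i] ([tiling_sum_prod]).  Reduce [z] modulo 2 to a word [z0].  A
   word [w] in [W] having no letter equal to the complement of the letter of
   [z0] at the same place gives a cube meeting [z0 + 2Z^d], so it lies in [Wm].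
   Choose such a word [v] with the fewest places where [v 0 i] is [z0 0 i] or
   its complement.  At the other places take [p i] to be 1 at [v 0 i], -1 at
   its complement and 0 elsewhere; at the chosen places take 1 at [z0 0 i], 0
   at its complement and 1/2 elsewhere.  By minimality only words of [Wm] in
   the class of [v] contribute to the sum, each of them contributes 1, and
   [v] does contribute, so the product of the [c i] is positive.  As [c i = 0]
   at the other places, there are none, which means that [v = z0]. *)

(** * Weighted coverings of the unit interval *)

(** Level sets are differences of sublevel sets, so [f] sums to 0 over each level set of [r], on
    which [Q (r e)] is constant. *)
Lemma sum_comp_eq0 (R : realDomainType) (E : finType) (f r : E -> R)
    (Q : R -> R) :
  (forall e0, \sum_(e | r e <= r e0) f e = 0) -> \sum_e f e * Q (r e) = 0.
Proof.
move=> f0.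
(* A strict sublevel set is either empty or the sublevel set of one of its points maximizing [r]. *)
have lt0 e0 : \sum_(e | r e < r e0) f e = 0.
  have [e1 e1P|none] := pickP (fun e => r e < r e0); last first.
    by rewrite big_pred0.
  case: (@Order.TotalTheory.arg_maxP _ _ _ e1 (fun e => r e < r e0) r e1P).
  move=> e2 e2P maxe2; apply: etrans (f0 e2); apply: eq_bigl => e.
  by apply/idP/idP => [/maxe2 //|/le_lt_trans]; apply.
have eq0 e0 : \sum_(e | r e == r e0) f e = 0.
  rewrite -(addr0 (\sum_(e | _) _)) -{2}(lt0 e0) -[RHS](f0 e0).
  rewrite [RHS](bigID (fun e => r e == r e0)) /=; congr (_ + _).
    by apply: eq_bigl => e; case: eqP => [->|]; rewrite ?lexx ?andbF.
  by apply: eq_bigl => e; rewrite lt_neqAle andbC.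
pose V := undup (map r (enum E)).
have rV e : r e \in V by rewrite mem_undup map_f ?mem_enum.
transitivity (\sum_e \sum_(v <- V | r e == v) f e * Q v).
  apply: eq_bigr => e _; rewrite big_mkcond (bigD1_seq (r e)) ?undup_uniq //=.
  by rewrite eqxx big1 ?addr0 // => v; rewrite eq_sym => /negbTE->.
rewrite (exchange_big_dep xpredT) //= big_seq big1 // => v.
rewrite mem_undup => /mapP[e0 _ ->].
by rewrite -big_distrl /= eq0 mul0r.
Qed.

Definition covers (R : realType) (s x : R) : bool := s <= x < s + 1.

(** As [x] runs through [0,1], a positive letter starts covering [x] at itself and a nonpositive one
    stops at its complement. Constant coverage makes these jumps cancel, so a letter and its
    complement carry equal total weight. *)
Lemma sum_covers_compl (R : realType) (E : finType) (a s : E -> R)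
    (p : R -> R) (c k : R) :
  (forall e, alphabet (s e)) ->
  (forall x : R, 0 <= x <= 1 -> \sum_e a e * (covers (s e) x)%:R = c) ->
  (forall t, alphabet t -> p t + p (compl t) = k) ->
  \sum_e a e * p (s e) = c * k.
Proof.
move=> sS sc pk.
(* The place of the jump, which is the positive one of [s e] and its complement; [b e] is the
   direction of the jump. *)
pose r e := if 0 < s e then s e else s e + 1.
pose b e : R := if 0 < s e then 1 else -1.
have r01 e : 0 < r e <= 1.
  by move: (sS e); rewrite /alphabet /r /= => ?; case: (ltP 0 (s e)) => ?; lra.
have coversE e (x : R) : 0 <= x <= 1 ->
    (covers (s e) x)%:R = b e * (r e <= x)%R%:R + (s e <= 0)%R%:R :> R.
  move: (sS e); rewrite /alphabet /covers /r /b /= => ss xx.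
  case: (ltP 0 (s e)) => h.
    rewrite (_ : x < s e + 1) ?andbT; last by lra.
    by rewrite mul1r addr0.
  rewrite (_ : s e <= x) /=; last by lra.
  by rewrite ltNge; case: (s e + 1 <= x) => /=; lra.
(* The coverage at [x = 0], before any jump. *)
have sum_neg : \sum_e a e * (s e <= 0)%R%:R = c.
  rewrite -(sc 0) ?lexx ?ler01 //; apply: eq_bigr => e _.
  rewrite coversE ?lexx ?ler01 // (_ : r e <= 0 = false) ?mulr0 ?add0r //.
  by have /andP[r0 _] := r01 e; rewrite leNgt r0.
have sumr0 e0 : \sum_(e | r e <= r e0) a e * b e = 0.
  have /andP[r0 r1] := r01 e0.
  have h : 0 <= r e0 <= 1 by rewrite (ltW r0).
  have := sc _ h; under eq_bigr do rewrite coversE // mulrDr mulrA.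
  rewrite big_split /= sum_neg -{2}[c]add0r => /addIr h0.
  rewrite -{}[RHS]h0 big_mkcond; apply: eq_bigr => e _.
  by case: ifP => _; rewrite ?mulr1 ?mulr0.
have := sum_comp_eq0 p sumr0 => h.
(* A nonpositive letter has [p (s e) = k - p (r e)], a positive one [p (s e) = p (r e)]. *)
transitivity (\sum_e (a e * b e * p (r e) + k * (a e * (s e <= 0)%R%:R))); last first.
  by rewrite big_split /= h add0r -big_distrr /= sum_neg mulrC.
apply: eq_bigr => e _; rewrite /b /r; have := pk _ (sS e); rewrite /compl.
by case: (ltP 0 (s e)) => ? ? /=; [rewrite mulr1 !mulr0 addr0|nra].
Qed.

(** * Tiles meeting the closed unit cube and sums over them *)

Section Tiling.
Variables (R : realType) (d : nat).
Implicit Types (t u v w x : 'rV[R]_d) (T : set 'rV[R]_d).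

Lemma cubeP t x : cube t x <-> forall i, covers (t 0 i) (x 0 i).
Proof.
split=> [[y yI <-] i|h].
  by move: (yI i); rewrite /covers !mxE => ?; lra.
exists (x - t); last by rewrite subrK.
by move=> i; rewrite !mxE; move: (h i); rewrite /covers => ?; lra.
Qed.

Definition vertex (e : {ffun 'I_d -> bool}) : 'rV[R]_d := \row_i (e i)%:R.

Lemma covers_vertex (s : R) (b : bool) :
  alphabet s -> covers s b%:R = (b == (0 < s)).
Proof.
rewrite /alphabet /covers /= => sS.
by apply/idP/idP; case: b; case: (ltP 0 s) => ? //= ?; lra.
Qed.

(* A word t covers exactly one vertex of the unit cube, so the tiles meeting
   the closed unit cube are indexed by its vertices. *)
Lemma tiles_by_vertex T : cube_tiling T ->
  exists tau : {ffun 'I_d -> bool} -> 'rV[R]_d,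
    (forall e, meeting_closed_cube T (tau e)) /\
    forall x, closed_cube R d x -> exists e0, forall e,
      [forall i, covers (tau e 0 i) (x 0 i)] = (e == e0).
Proof.
move=> [Tcov Tdis].
have cov x : exists t, T t /\ cube t x.
  have : (\bigcup_(t in T) cube t) x by rewrite Tcov.
  by case=> t Tt tx; exists t.
have vertex_closed e : closed_cube R d (vertex e).
  by move=> i; rewrite mxE; case: (e i); rewrite ?lexx ?ler01.
have [tau tauP] := choice (fun e => cov (vertex e)).
have tauW e : meeting_closed_cube T (tau e).
  by have [Tt tv] := tauP e; split=> //; exists (vertex e).
exists tau; split=> // x xI.
have Teq u v y : T u -> T v -> cube u y -> cube v y -> u = v.
  move=> Tu Tv uy vy; apply: contrapT => uv.
  by have : (cube u `&` cube v) y by []; rewrite Tdis.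
have [t [Tt tx]] := cov x.
have tS : words R d t by apply: (@meeting_closed_cube_words _ _ T); split=> //; exists x.
(* By [covers_vertex], the signs of the letters give the one vertex that the cube of a word
   contains. *)
pose sg u : {ffun 'I_d -> bool} := [ffun i => 0 < u 0 i].
have tau_t : tau (sg t) = t.
  have [T1 c1] := tauP (sg t); apply: (Teq _ _ _ T1 Tt c1).
  by apply/cubeP => i; rewrite mxE covers_vertex ?ffunE.
have sg_tau e : sg (tau e) = e.
  apply/ffunP => i; rewrite ffunE; have [_ /cubeP/(_ i)] := tauP e.
  by rewrite mxE covers_vertex => [/eqP//|]; apply: meeting_closed_cube_words (tauW e) i.
exists (sg t) => e; apply/forallP/eqP => [h|-> i]; last first.
  by rewrite tau_t; move/cubeP: tx.
rewrite -(sg_tau e); congr sg; apply: (Teq _ _ x) => //.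
  by have [] := tauP e.
by apply/cubeP.
Qed.

(* The factors covers (w 0 i) (x 0 i), whose product is the indicator of the
   cube at w, are replaced by p i (w 0 i) one coordinate at a time. *)
Lemma tiling_sum_prod (E : finType) (tau : E -> 'rV[R]_d)
    (p : 'I_d -> R -> R) (c : 'I_d -> R) :
  (forall e, words R d (tau e)) ->
  (forall x, closed_cube R d x -> exists e0, forall e,
      [forall i, covers (tau e 0 i) (x 0 i)] = (e == e0)) ->
  (forall i s, alphabet s -> p i s + p i (compl s) = c i) ->
  \sum_e \prod_i p i (tau e 0 i) = \prod_i c i.
Proof.
move=> tauS tauP pc.
pose F k x e (i : 'I_d) : R := if (i < k)%N then p i (tau e 0 i)
                      else (covers (tau e 0 i) (x 0 i))%:R.
suff main k : (k <= d)%N -> forall x, closed_cube R d x ->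
    \sum_e \prod_(i < d) F k x e i = \prod_(i < d) (if (i < k)%N then c i else 1).
  (* At [k = d] no factor depends on the point, so any point of the closed cube serves. *)
  have I0 : closed_cube R d 0 by move=> i; rewrite mxE lexx ler01.
  have := main d (leqnn d) 0 I0; rewrite [RHS](eq_bigr c); last first.
    by move=> i _; rewrite ltn_ord.
  move=> <-; apply: eq_bigr => e _; apply: eq_bigr => i _.
  by rewrite /F ltn_ord.
elim: k => [_|k IH kd] x xI.
  have [e0 e0P] := tauP x xI.
  rewrite [RHS]big1 // (bigD1 e0) //= [X in _ + X]big1 ?addr0.
    apply: big1 => i _; rewrite /F /=.
    by have := e0P e0; rewrite eqxx => /forallP ->.
  move=> e /negbTE; rewrite -e0P => /negbT; rewrite negb_forall => /existsP[i ni].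
  by apply/eqP/prodf_eq0; exists i => //; rewrite /F /= (negbTE ni).
pose o := Ordinal kd.
have ltS (i : 'I_d) : i != o -> (i < k.+1)%N = (i < k)%N.
  by rewrite ltnS leq_eqVlt -val_eqE /= => /negbTE ->.
pose a e := \prod_(i < d | i != o) F k x e i.
rewrite (bigD1 o) //= ltnSn mulrC.
under eq_bigr do rewrite (bigD1 o) //= mulrC /F ltnSn.
rewrite (eq_bigr (fun e => a e * p o (tau e 0 o))); last first.
  by move=> e _; congr (_ * _); apply: eq_bigr => i /ltS ->.
apply: sum_covers_compl => [e|y y01|]; [exact: tauS| |exact: pc].
(* Moving only coordinate [o] leaves the weights [a e] unchanged, so the induction hypothesis at
   [xy] is the constant coverage needed. *)
pose xy : 'rV[R]_d := \row_i (if i == o then y else x 0 i).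
have xyI : closed_cube R d xy by move=> i; rewrite mxE; case: ifP.
have := IH (ltnW kd) xy xyI; rewrite [RHS](bigD1 o) //= ltnn mul1r.
rewrite [RHS](eq_bigr (fun i : 'I_d => if (i < k.+1)%N then c i else 1)); last first.
  by move=> i /ltS ->.
move=> <-; apply: eq_bigr => e _; rewrite [RHS](bigD1 o) //= mulrC /F ltnn mxE eqxx.
congr (_ * _); apply: eq_bigr => i /negbTE io; rewrite /F !mxE io //.
Qed.

End Tiling.

(** * Complements, signs and induced decompositions *)

Section Signs.
Variables (R : realType) (d : nat).
Implicit Types (s t : R) (u v w : 'rV[R]_d).

Lemma compl_alphabet s : alphabet s -> alphabet (compl s).
Proof. by move=> sS; have [_ /(_ erefl)] := complP (compl s) sS; case. Qed.

Lemma complK s : alphabet s -> compl (compl s) = s.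
Proof.
move=> sS; apply/esym/(complP _ (compl_alphabet sS)); split=> //.
by have [_ /(_ erefl)[_]] := complP (compl s) sS; rewrite distrC.
Qed.

Lemma compl_neq s : (compl s == s) = false.
Proof. by apply/eqP; rewrite /compl; case: ltP => _; lra. Qed.

Lemma neq_compl s : (s == compl s) = false.
Proof. by rewrite eq_sym compl_neq. Qed.

Lemma eq_compl s t : alphabet s -> alphabet t -> (compl s == t) = (s == compl t).
Proof.
by move=> sS tS; apply/eqP/eqP => [<-|->]; rewrite complK.
Qed.

Definition letter_value (a b c : R) t s : R :=
  if s == t then a else if s == compl t then b else c.

(** The pair of [s] and its complement is either that of [t], with values [a] and [b], or disjoint
    from it, with [c] taken twice. *)
Lemma letter_value_compl a b c t s : a + b = 2 * c ->
  alphabet t -> alphabet s ->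
  letter_value a b c t s + letter_value a b c t (compl s) = a + b.
Proof.
move=> abc tS sS; rewrite /letter_value !eq_compl ?complK //; last first.
  exact: compl_alphabet.
have [->|_] := eqVneq s t; first by rewrite neq_compl.
by case: ifP => _; lra.
Qed.

(** On [flips u] this is $(-1)^{|\varepsilon|}$, written as a product over coordinates to match the
    terms of [tiling_sum_prod]. *)
Definition sign u v : R := \prod_i (if u 0 i == v 0 i then 1 else -1).

Lemma flipsP u v :
  flips u v <-> forall i, v 0 i = u 0 i \/ v 0 i = compl (u 0 i).
Proof.
split=> [[e _ <-] i|h].
  by rewrite mxE; case: ifP; [right|left].
exists (\row_i (v 0 i == compl (u 0 i))%:R) => //.
apply/rowP => i; rewrite !mxE.
by case: (h i) => ->; rewrite ?neq_compl ?eqxx.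
Qed.

Lemma same_signP u v : same_sign u v <-> flips u v /\ sign u v = 1.
Proof.
have signE e : sign u (flip u e) = (-1) ^+ weight e.
  rewrite /weight -prodr_const [RHS]big_mkcond; apply: eq_bigr => i _.
  by rewrite inE mxE; case: (e 0 i == 1); rewrite ?eqxx ?neq_compl.
have odd1 (S : numDomainType) n : ((-1) ^+ n == 1 :> S) = ~~ odd n.
  rewrite -signr_odd; case: (odd n); rewrite ?expr0 ?eqxx // expr1.
  by rewrite eq_sym -addr_eq0 (_ : 1 + 1 = 2%:R :> S) // pnatr_eq0.
split=> [[e [<- we]]|[[e _ <-] h]].
  split; first by exists e.
  by apply/eqP; rewrite signE odd1 -(odd1 int); apply/eqP.
by exists e; split=> //; apply/eqP; rewrite odd1 -(odd1 R) -signE; apply/eqP.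
Qed.

Lemma flips_sub w u : words R d w -> flips w u -> flips u `<=` flips w.
Proof.
move=> wS /flipsP wu v /flipsP uv; apply/flipsP => i.
by case: (uv i) (wu i) => -> [->|->]; rewrite ?complK; auto.
Qed.

Lemma flips_sym w u : words R d w -> flips w u -> flips u w.
Proof.
move=> wS /flipsP wu; apply/flipsP => i.
by case: (wu i) => ->; rewrite ?complK; auto.
Qed.

Lemma flips_words w u : words R d w -> flips w u -> words R d u.
Proof.
move=> wS /flipsP wu i; case: (wu i) => ->; first exact: wS.
exact: compl_alphabet.
Qed.

Lemma flips_eq w u : words R d w -> flips w u -> flips u = flips w.
Proof.
move=> wS wu; apply/seteqP; split; first exact: flips_sub.
by apply: flips_sub; [exact: flips_words wu|exact: flips_sym].
Qed.

(** Each coordinate offers only two letters, so two of any three agree and the factors multiply. *)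
Lemma sign_trans w u v x : words R d w ->
  flips w u -> flips w v -> flips w x -> sign u v * sign v x = sign u x.
Proof.
move=> wS /flipsP wu /flipsP wv /flipsP wx; rewrite -big_split /=.
apply: eq_bigr => i _.
by case: (wu i) (wv i) (wx i) => -> [->|->] [->|->];
  rewrite ?eqxx ?neq_compl ?compl_neq; lra.
Qed.

Lemma sign_sym u v : sign u v = sign v u.
Proof. by apply: eq_bigr => i _; rewrite eq_sym. Qed.

Lemma sign_cases u v : sign u v = 1 \/ sign u v = -1.
Proof.
rewrite /sign; elim/big_rec: _ => [|i y _ [->|->]]; [by left| |];
  by case: ifP => _; rewrite ?mul1r ?mulN1r ?opprK; auto.
Qed.

Lemma sign_class_eq w u v : words R d w -> flips w u -> flips w v ->
  sign u v = 1 -> sign_class (flips w) u = sign_class (flips w) v.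
Proof.
move=> wS wu wv uv; apply/seteqP; split=> x [wx /same_signP[_ ux]];
  (split=> //; apply/same_signP; split; first by
    rewrite (flips_eq wS)).
  by rewrite -(sign_trans wS wv wu wx) sign_sym uv ux mulr1.
by rewrite -(sign_trans wS wu wv wx) uv ux mulr1.
Qed.

Section Decomposition.
Variables W Wp Wm : set 'rV[R]_d.
Hypothesis Wwords : W `<=` words R d.
Hypothesis dec : induced_decomposition W Wp Wm.

(** If [w] had sign -1 against representatives of both classes, these would carry the same sign and
    the classes would coincide. *)
Lemma decomposition_cover w : W w -> ~ Wp w -> Wm w.
Proof.
case: dec => cp [cm [ori -> ->]] Ww nWp; split=> //; exists w => //.
have ww : flips w w by apply/flipsP; left.
have wS := Wwords Ww.
have [[u wu cpE] [v wv cmE] neq] := ori w Ww.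
have uw : sign u w = -1.
  case: (sign_cases u w) => // uw; case: nWp; split=> //; exists w => //.
  rewrite cpE; split=> //; apply/same_signP; split=> //.
  exact: flips_sym.
rewrite cmE; split=> //; apply/same_signP; split; first exact: flips_sym.
case: (sign_cases v w) => // vw; case: neq; rewrite cpE cmE.
apply: sign_class_eq => //; rewrite -(sign_trans wS wu ww wv) uw sign_sym vw.
by lra.
Qed.

(** Different words of [W] may witness the two memberships, but they have the same set of flips, and
    [cm] depends on that set alone. *)
Lemma decomposition_sign u v : Wm u -> Wm v -> flips u v -> sign u v = 1.
Proof.
case: dec => cp [cm [ori _ ->]] [Wu [u' Wu' cu]] [Wv [v' Wv' cv]] uv.
have flipsE w w' : W w' -> cm (flips w') w -> flips w = flips w'.
  move=> Ww' cw; apply: (flips_eq (Wwords Ww')).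
  by have [_ [x _ cE] _] := ori w' Ww'; move: cw; rewrite cE => -[].
have uE := flipsE _ _ Wu' cu; rewrite -{}uE in cu.
have vE := flipsE _ _ Wv' cv; rewrite -{}vE (flips_eq (Wwords Wu) uv) in cv.
have [_ [x ux cE] _] := ori u Wu.
have uu : flips u u by apply/flipsP; left.
move: cu cv; rewrite cE => -[_ /same_signP[_ xu]] [_ /same_signP[_ xv]].
by rewrite -(sign_trans (Wwords Wu) uu ux uv) sign_sym xu xv mulr1.
Qed.

End Decomposition.
End Signs.

(** * Translations by [2Z^d] *)

Lemma word_mod2 (R : realType) (d : nat) (z : 'rV[R]_d) :
  exists k : 'rV[int]_d, words R d (z - \row_i (2 * (k 0 i)%:~R)).
Proof.
exists (\row_i Num.ceil ((z 0 i - 1) / 2)) => i; rewrite /alphabet /= !mxE.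
have := ceil_itv ((z 0 i - 1) / 2); rewrite intrD /= => ?; lra.
Qed.

(** Letters differ by less than 2, and by exactly 1 only when complementary. Otherwise a shift by
    -2, 0 or 2 brings them closer than 1, and the larger left endpoint lies in both intervals. *)
Lemma cube_meets_add_2Zd (R : realType) (d : nat) (u w : 'rV[R]_d) :
  words R d u -> words R d w -> (forall i, w 0 i != compl (u 0 i)) ->
  exists m : 'rV[int]_d,
    cube u `&` cube (w + \row_i (2 * (m 0 i)%:~R)) !=set0.
Proof.
move=> uS wS wu.
have near i : {m : int | `|u 0 i - (w 0 i + 2 * m%:~R)| < 1}.
  apply: cid; have := wu i; have := uS i; have := wS i.
  rewrite /alphabet /compl /= => ? ? /eqP wne.
  have [?|?] := ltP (u 0 i - w 0 i) (-1).
    by exists (-1); rewrite ltr_norml mulrN1z; lra.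
  have [?|?] := ltP 1 (u 0 i - w 0 i).
    by exists 1; rewrite ltr_norml mulr1z; lra.
  exists 0; rewrite ltr_norml mulr0 addr0.
  by move: wne; case: (ltP 0 (u 0 i)) => ? ?; lra.
exists (\row_i sval (near i)).
exists (\row_i Num.max (u 0 i) (w 0 i + 2 * (sval (near i))%:~R)).
by split; apply/cubeP => i; rewrite /covers !mxE; case: (near i) => m /=;
  rewrite ltr_norml => ?; case: (leP (u 0 i) (w 0 i + 2 * m%:~R)) => ?; lra.
Qed.

Theorem theorem11p6 (R : realType) (d : nat) (T Wp Wm : set 'rV[R]_d)
    (tilingT : cube_tiling T)
    (decW : induced_decomposition (meeting_closed_cube T) Wp Wm)
    (z : 'rV[R]_d)
    (disj : forall t, add_2Zd Wp t -> cube z `&` cube t = set0) :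
  add_2Zd Wm z.
Proof.
have [k] := word_mod2 z; set z0 := z - _ => zS.
have [tau [tauW tauP]] := tiles_by_vertex tilingT.
have Wwords := @meeting_closed_cube_words R d T.
have tauS e : words R d (tau e) by exact: Wwords (tauW e).
pose meets e := [forall i, tau e 0 i != compl (z0 0 i)].
have meets_Wm e : meets e -> Wm (tau e).
  move=> /forallP me; apply: (decomposition_cover Wwords decW) => // Wpe.
  have [m [y [zy ty]]] := cube_meets_add_2Zd zS (tauS e) me.
  suff: (cube z `&` cube (tau e + \row_i (2 * ((m + k) 0 i)%:~R)))
      (y + \row_i (2 * (k 0 i)%:~R)).
    by rewrite disj //; exists (tau e) => //; exists (m + k).
  by split; apply/cubeP => i; [move/cubeP/(_ i): zy|move/cubeP/(_ i): ty];
    rewrite /covers /z0 !mxE ?intrD; lra.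
have tiling_sum := tiling_sum_prod tauS tauP.
have half : 1 + 0 = 2 * 2^-1 :> R by lra.
pose h i := letter_value 1 0 2^-1 (z0 0 i).
(* Otherwise every product of values of [h] has a factor 0, although these products sum to 1. *)
have [e0 e0P] : exists e, meets e.
  apply: contrapT => none.
  have := tiling_sum h _ (fun i s sS => letter_value_compl half (zS i) sS).
  rewrite [RHS]big1 => [|i _]; last by rewrite addr0.
  rewrite big1 => [/esym/eqP|e _]; first by rewrite oner_eq0.
  have : ~~ meets e by apply/negP => me; apply: none; exists e.
  rewrite negb_forall => /existsP[i]; rewrite negbK => /eqP ei.
  apply/eqP/prodf_eq0; exists i => //.
  by rewrite /h /letter_value ei compl_neq eqxx.
pose A e := [pred i | (tau e 0 i == z0 0 i) || (tau e 0 i == compl (z0 0 i))].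
have [v mv vmin] := arg_minnP (fun e => #|A e|) e0P.
pose p i := if i \in A v then h i else letter_value 1 (-1) 0 (tau v 0 i).
pose c i : R := if i \in A v then 1 else 0.
have pc i s : alphabet s -> p i s + p i (compl s) = c i.
  move=> sS; rewrite /p /c; case: ifP => _.
    by rewrite letter_value_compl // addr0.
  by rewrite letter_value_compl ?subrr ?mulr0 //; exact: tauS.
have v_eq i : i \in A v -> tau v 0 i = z0 0 i.
  by rewrite inE => /orP[/eqP //|]; rewrite (negbTE (forallP mv i)).
have term e : \prod_i p i (tau e 0 i) != 0 -> \prod_i p i (tau e 0 i) = 1.
  move=> /prodf_neq0 pe.
  have pe_in i : i \in A v -> tau e 0 i != compl (z0 0 i).
    move=> iA; have := pe i isT; rewrite /p iA /h /letter_value.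
    have [->|_] := eqVneq (tau e 0 i) (z0 0 i); first by rewrite neq_compl.
    by have [_|//] := eqVneq (tau e 0 i) (compl (z0 0 i)); rewrite eqxx.
  have pe_out i : i \notin A v ->
      tau e 0 i = tau v 0 i \/ tau e 0 i = compl (tau v 0 i).
    move=> iA; have := pe i isT; rewrite /p (negbTE iA) /letter_value.
    have [->|_] := eqVneq (tau e 0 i) (tau v 0 i); first by left.
    have [->|_] := eqVneq (tau e 0 i) (compl (tau v 0 i)); first by right.
    by rewrite eqxx.
  (* The letter of [tau e] is that of [tau v] or its complement, and the pair of [z0 0 i] is closed
     under complement. *)
  have out i : i \notin A v -> i \notin A e.
    move=> iA; move: (iA); rewrite !inE !negb_or => /andP[n1 n2].
    case: (pe_out i iA) => ->; first by rewrite n1 n2.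
    have zSi := zS i; have vSi := tauS v i; have zSc := compl_alphabet zSi.
    by rewrite !eq_compl ?complK // n1 n2.
  have me : meets e.
    apply/forallP => i; have [/pe_in //|/out] := boolP (i \in A v).
    by rewrite inE negb_or => /andP[].
  have AeAv : A e \subset A v.
    by apply/fintype.subsetP => i; apply: contraLR => /out.
  (* Minimality of [v] turns the inclusion into equality, so [tau e] and [tau v] both agree with
     [z0] on [A v]. *)
  have AE : A e =i A v.
    apply/subset_cardP => //; apply/eqP.
    by rewrite eqn_leq vmin // andbT subset_leq_card.
  have e_eq i : i \in A v -> tau e 0 i = tau v 0 i.
    move=> iA; rewrite v_eq //; move: (iA); rewrite -AE inE.
    by rewrite (negbTE (pe_in i iA)) orbF => /eqP.
  have ve : flips (tau v) (tau e).
    apply/flipsP => i; have [/e_eq ->|/pe_out//] := boolP (i \in A v).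
    by left.
  (* The product is now, factor by factor, the sign of [tau v] against [tau e]. *)
  rewrite -[RHS](decomposition_sign Wwords decW (meets_Wm v mv) (meets_Wm e me) ve).
  apply: eq_bigr => i _; rewrite /p /h /letter_value; case: ifP => iA.
    by rewrite e_eq // v_eq // !eqxx.
  have [->|->] := pe_out i (negbT iA); first by rewrite eqxx.
  by rewrite compl_neq eqxx neq_compl.
have term_ge0 e : 0 <= \prod_i p i (tau e 0 i).
  by have [->//|/term ->] := eqVneq (\prod_i p i (tau e 0 i)) 0; rewrite ler01.
have termv : \prod_i p i (tau v 0 i) = 1.
  apply: big1 => i _; rewrite /p /h /letter_value; case: ifP => iA.
    by rewrite v_eq // eqxx.
  by rewrite eqxx.
have cpos : 0 < \prod_i c i.
  rewrite -(tiling_sum p c pc) (bigD1 v) //= termv.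
  by rewrite ltr_pwDl ?ltr01 // sumr_ge0.
have vz : tau v = z0.
  apply/rowP => i; apply: v_eq; apply: contraTT cpos => iA.
  by rewrite (bigD1 i) //= /c (negbTE iA) mul0r ltxx.
exists z0; first by rewrite -vz; exact: meets_Wm.
by exists k => //; rewrite subrK.
Qed.
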